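(* Let $X$ be a $\mathbb{Z}$-valued random variable with $\mathbb{P}(X=k)=\frac{1}{\sqrt{2}\,G}\operatorname{sech}(\pi k)$ for $k\in\mathbb{Z}$. Then $\mathbb{E}[X^n]=0$ for every odd $n\in\mathbb{N}$, and \begin{align*} (i)\quad &\mathbb{E}[X^2]=\mathrm{Var}(X)=\left(\frac{G}{2}\right)^2,\\ (ii)\quad &\mathbb{E}[X^4]=9\left(\frac{G}{2}\right)^4,\\ (iii)\quad &\mathbb{E}[X^6]=153\left(\frac{G}{2}\right)^6,\\ (iv)\quad &\mathbb{E}[X^8]=4977\left(\frac{G}{2}\right)^8. \end{align*}
   Context: $\operatorname{sech}(x)=1/\cosh(x)$. $\varpi=\Gamma^2(1/4)/(2\sqrt{2\pi})$ is the lemniscate constant and $G=\varpi/\pi$ is Gauss' constant. The given law is a probability distribution on $\mathbb{Z}$, i.e. $\sum_{k\in\mathbb{Z}}\operatorname{sech}(\pi k)=\sqrt{2}\,G$; it is called the first discrete bilateral hyperbolic secant distribution $\mathsf{Sech}_{1,b}$. *)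

(* Defs.v *)
From HB Require Import structures.
From mathcomp Require Import all_boot all_order all_algebra.
From mathcomp Require Import all_classical all_reals all_analysis.

Set Implicit Arguments.
Unset Strict Implicit.
Unset Printing Implicit Defensive.

Import Order.TTheory GRing.Theory Num.Theory.
Import numFieldNormedType.Exports.

Local Open Scope classical_set_scope.
Local Open Scope ring_scope.

(* The integers carry the discrete sigma-algebra (all sets are measurable),
   as nat does in MathComp-Analysis, so that {RV P >-> int} is the type of
   Z-valued random variables. *)
HB.instance Definition _ := isPointed.Build int 0.
HB.instance Definition _ := @isMeasurable.Build default_measure_display
  int discrete_measurable discrete_measurable0
  discrete_measurableC discrete_measurableU.

Section constants.
Context {R : realType}.
Implicit Types x t : R.

Definition cosh x : R := (expR x + expR (- x)) / 2.

Definition sech x : R := 1 / cosh x.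

(* Euler's integral; it is the Gamma function for x > 0 only. *)
Definition Gamma x : R :=
  (\int[lebesgue_measure]_(t in `]0%R, +oo[) (t `^ (x - 1) * expR (- t)))%R.

Definition lemniscate : R := Gamma (1 / 4) ^+ 2 / (2 * Num.sqrt (2 * pi)).

Definition gauss : R := lemniscate / pi.

End constants.

(* Main.v *)
Require Import Defs.
From HB Require Import structures.
From mathcomp Require Import all_boot all_order all_algebra.
From mathcomp Require Import all_classical all_reals all_analysis.
From mathcomp Require Import measurable_realfun ring lra zify.

Set Implicit Arguments.
Unset Strict Implicit.
Unset Printing Implicit Defensive.

Import Order.TTheory GRing.Theory Num.Theory.
Import numFieldNormedType.Exports.

Local Open Scope classical_set_scope.
Local Open Scope ring_scope.

(* Put A(h) = sum_n sech(n h) over the integers.  The law being a probability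
   gives A(pi) = sqrt 2 G, so only identities between sums of n^k sech(pi n) are
   needed and the Gamma function plays no role.

   Write f and c for the restrictions of n |-> sech(n h) to even and odd n, and s
   for that of 1 / sinh(n h) to odd n.  These are the Fourier coefficients of the
   Jacobi functions dn, cn, sn.  The addition formulas turn the convolutions
   s * c, s * f and f * c into telescoping sums of tanh, with the result n f(n),
   n c(n) and n s(n); this is the differential system of dn, cn, sn, and it
   expresses every moment of f, c, s through the sums of f and of c.

   The same telescoping gives (A(h) - A(2h))^2 = 4 A(4h) (A(2h) - A(4h)).  Hence
   both (A(2^n pi), 2 A(2^(n+1) pi) - A(2^n pi)) and
   2^-n (A(pi / 2^n), A(pi / 2^(n+1)) - A(pi / 2^n)) are arithmetic-geometric mean
   iterations starting from A(pi).  Comparing A with the integral of sech, whose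
   primitive is atan o sinh, both tend to 1; so their second initial values agree,
   and this gives (sum c)^2 = (sum f)^2 / 2 at h = pi / 2. *)

(** * Unordered summation *)

Section has_sum.
Context {R : realType} {T : choiceType}.
Implicit Types (u v p q : T -> R) (a b c l : R).

(** The sum is taken in the extended reals; equating it with a real number makes it convergent. *)
Definition has_nnsum p a :=
  (forall i, 0 <= p i) /\ (\esum_(i in [set: T]) (p i)%:E)%E = a%:E.

(* Only absolutely summable families have a sum. *)
Definition has_sum u l := exists p q a b,
  [/\ has_nnsum p a, has_nnsum q b, (forall i, u i = p i - q i) & l = a - b].

Lemma has_nnsumD p q a b :
  has_nnsum p a -> has_nnsum q b -> has_nnsum (fun i => p i + q i) (a + b).
Proof.
move=> [p0 pa] [q0 qb]; split=> [i|]; first exact: addr_ge0.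
by rewrite EFinD -pa -qb -esumD// => i _; rewrite lee_fin.
Qed.

Lemma has_nnsum_term p a : has_nnsum p a -> forall i, 0 <= p i.
Proof. by case. Qed.

Lemma has_nnsum_inj p a b : has_nnsum p a -> has_nnsum p b -> a = b.
Proof. by move=> [_ pa] [_]; rewrite pa => -[]. Qed.

Lemma has_nnsum_ge0 p a : has_nnsum p a -> 0 <= a.
Proof.
by move=> [p0 pa]; rewrite -lee_fin -pa esum_ge0// => i _; rewrite lee_fin.
Qed.

Lemma has_nnsum0 : has_nnsum (fun=> 0) 0.
Proof. by split=> //; rewrite esum1. Qed.

Lemma eq_has_nnsum p q a : p =1 q -> has_nnsum p a -> has_nnsum q a.
Proof. by move=> /funext ->. Qed.

Lemma has_nnsum_le p q b : has_nnsum q b -> (forall i, 0 <= p i <= q i) ->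
  exists2 a, has_nnsum p a & a <= b.
Proof.
move=> [q0 qb] pq.
have pb : (\esum_(i in [set: T]) (p i)%:E <= b%:E)%E.
  by rewrite -qb; apply: le_esum => i _; rewrite lee_fin; have /andP[] := pq i.
have p0 : (0 <= \esum_(i in [set: T]) (p i)%:E)%E.
  by apply: esum_ge0 => i _; rewrite lee_fin; have /andP[] := pq i.
have pfin : \esum_(i in [set: T]) (p i)%:E \is a fin_num.
  by rewrite ge0_fin_numE// (le_lt_trans pb)// ltry.
exists (fine (\esum_(i in [set: T]) (p i)%:E)); last by rewrite -lee_fin fineK.
by split=> [i|]; [have /andP[] := pq i|rewrite fineK].
Qed.

Lemma has_nnsumZ p a c : 0 <= c -> has_nnsum p a ->
  has_nnsum (fun i => c * p i) (c * a).
Proof.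
(* Finite partial sums give only this inequality; the converse is the same bound for the factor
   [c^-1]. *)
have le k q b : 0 <= k -> has_nnsum q b ->
    (\esum_(i in [set: T]) (k * q i)%:E <= (k * b)%:E)%E.
  move=> k0 [q0 qb]; rewrite ge_ereal_sup => //= _ [X [finX XT]] <-.
  rewrite fsbig_finite//= sumEFin -mulr_sumr lee_fin ler_wpM2l//.
  rewrite -lee_fin -qb -sumEFin -fsbig_finite//=.
  by apply: ereal_sup_ubound; exists X.
rewrite le_eqVlt => /predU1P[<- [p0 pa]|c0 pa].
  by rewrite mul0r; apply: eq_has_nnsum has_nnsum0 => i; rewrite mul0r.
have cp0 i : 0 <= c * p i by rewrite mulr_ge0 ?(ltW c0) ?(has_nnsum_term pa).
have := le _ _ _ (ltW c0) pa.
have [_ e] := pa; have fin : \esum_(i in [set: T]) (c * p i)%:E \is a fin_num.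
  rewrite ge0_fin_numE; last by apply: esum_ge0 => i _; rewrite lee_fin.
  by rewrite (le_lt_trans (le _ _ _ (ltW c0) pa))// ltry.
move=> h1; split=> //.
have hc : has_nnsum (fun i => c * p i) (fine (\esum_(i in [set: T]) (c * p i)%:E)).
  by split=> //; rewrite fineK.
have := le c^-1 _ _ _ hc; rewrite invr_ge0 (ltW c0) => /(_ isT).
rewrite (_ : (fun i => _) = (fun i => (p i)%:E)); last first.
  by apply/funext => i; rewrite mulKf// gt_eqF.
rewrite e lee_fin ler_pdivlMl// => h2.
by apply/eqP; rewrite eq_le h1 -(fineK fin) lee_fin.
Qed.

Lemma nnsum_has_sum p a : has_nnsum p a -> has_sum p a.
Proof.
move=> pa; exists p, (fun=> 0), a, 0.
by split; [|exact: has_nnsum0|move=> i; rewrite subr0|rewrite subr0].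
Qed.

Lemma eq_has_sum u v a : u =1 v -> has_sum u a -> has_sum v a.
Proof. by move=> /funext ->. Qed.

(** Two decompositions satisfy [p + q' = p' + q], an equality of non-negative families, whose sums
    are unique. *)
Lemma has_sum_inj u a b : has_sum u a -> has_sum u b -> a = b.
Proof.
move=> [p [q [x [y [px qy upq ->]]]]] [p' [q' [x' [y' [px' qy' upq' ->]]]]].
have h1 := has_nnsumD px qy'; have h2 := has_nnsumD px' qy.
have /(has_nnsum_inj h1) e : has_nnsum (fun i => p i + q' i) (x' + y).
  by apply: eq_has_nnsum h2 => i; have := upq i; rewrite upq'; lra.
by lra.
Qed.

Lemma has_sum_nnsum u a : (forall i, 0 <= u i) -> has_sum u a -> has_nnsum u a.
Proof.
move=> u0 [p [q [x [y [px qy upq ->]]]]].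
have [|z uz _] := @has_nnsum_le u p x px.
  by move=> i; rewrite u0 upq gerBl (has_nnsum_term qy).
suff -> : x - y = z by [].
apply: has_sum_inj (nnsum_has_sum uz).
by exists p, q, x, y.
Qed.

Lemma has_sumD u v a b :
  has_sum u a -> has_sum v b -> has_sum (fun i => u i + v i) (a + b).
Proof.
move=> [p [q [x [y [px qy upq ->]]]]] [p' [q' [x' [y' [px' qy' upq' ->]]]]].
exists (fun i => p i + p' i), (fun i => q i + q' i), (x + x'), (y + y').
split; [exact: has_nnsumD|exact: has_nnsumD|move=> i|by lra].
by rewrite upq upq'; lra.
Qed.

Lemma has_sumN u a : has_sum u a -> has_sum (fun i => - u i) (- a).
Proof.
move=> [p [q [x [y [px qy upq ->]]]]]; exists q, p, y, x; split=> //.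
- by move=> i; rewrite upq opprB.
- by rewrite opprB.
Qed.

Lemma has_sumB u v a b :
  has_sum u a -> has_sum v b -> has_sum (fun i => u i - v i) (a - b).
Proof. by move=> ua vb; exact: has_sumD ua (has_sumN vb). Qed.

Lemma has_sumZ u a c : has_sum u a -> has_sum (fun i => c * u i) (c * a).
Proof.
have pos k : 0 <= k -> has_sum u a -> has_sum (fun i => k * u i) (k * a).
  move=> k0 [p [q [x [y [px qy upq ->]]]]].
  exists (fun i => k * p i), (fun i => k * q i), (k * x), (k * y).
  split; [exact: has_nnsumZ|exact: has_nnsumZ|move=> i|by rewrite mulrBr].
  by rewrite upq mulrBr.
move=> ua; have [c0|c0] := leP 0 c; first exact: pos.
have := has_sumN (pos (- c) _ ua); rewrite oppr_ge0 (ltW c0) => /(_ isT).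
by rewrite mulNr opprK; apply: eq_has_sum => i; rewrite mulNr opprK.
Qed.

Lemma has_sum0 : has_sum (fun=> 0) 0.
Proof. exact: nnsum_has_sum has_nnsum0. Qed.

Lemma has_sum_sum (I : Type) (r : seq I) (u : I -> T -> R) (a : I -> R) :
  (forall k, has_sum (u k) (a k)) ->
  has_sum (fun i => \sum_(k <- r) u k i) (\sum_(k <- r) a k).
Proof.
move=> ua; elim: r => [|k r ih].
  by rewrite big_nil; apply: eq_has_sum has_sum0 => i; rewrite big_nil.
rewrite big_cons; apply: eq_has_sum (has_sumD (ua k) ih) => i.
by rewrite big_cons.
Qed.

(** The decomposition behind [has_sum] is arbitrary; this canonical one transports along injections
    and matches the definition of the Lebesgue integral. *)
Lemma has_sum_posneg u a : has_sum u a -> exists b c,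
  [/\ has_nnsum (fun i => Num.max (u i) 0) b,
      has_nnsum (fun i => Num.max (- u i) 0) c & a = b - c].
Proof.
move=> ua; have [p [q [x [y [px qy upq _]]]]] := ua.
have [|b ub _] := @has_nnsum_le (fun i => Num.max (u i) 0) p x px.
  move=> i; rewrite le_max lexx orbT ge_max upq gerBl.
  by rewrite (has_nnsum_term px) (has_nnsum_term qy).
have [|c uc _] := @has_nnsum_le (fun i => Num.max (- u i) 0) q y qy.
  move=> i; rewrite le_max lexx orbT ge_max upq opprB gerBl.
  by rewrite (has_nnsum_term px) (has_nnsum_term qy).
exists b, c; split=> //; apply: has_sum_inj ua _.
by exists (fun i => Num.max (u i) 0), (fun i => Num.max (- u i) 0), b, c;
  split=> // i; case: (leP (u i) 0); case: (leP (- u i) 0); lra.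
Qed.

Lemma has_sum_le u v a b :
  (forall i, u i <= v i) -> has_sum u a -> has_sum v b -> a <= b.
Proof.
move=> uv ua vb; rewrite -subr_ge0.
apply: (@has_nnsum_ge0 (fun i => v i - u i)).
by apply: has_sum_nnsum (has_sumB vb ua) => i; rewrite subr_ge0.
Qed.

Lemma has_sum_dominated u v b : (forall i, `|u i| <= v i) -> has_sum v b ->
  exists a, has_sum u a.
Proof.
move=> uv vb.
have v0 i : 0 <= v i by exact: le_trans (uv i).
have /has_sum_nnsum - /(_ v0) {}vb := vb.
have [|x px _] := @has_nnsum_le (fun i => Num.max (u i) 0) v b vb.
  by move=> i; rewrite le_max lexx orbT ge_max v0 andbT (le_trans _ (uv i))// ler_norm.
have [|y qy _] := @has_nnsum_le (fun i => Num.max (- u i) 0) v b vb.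
  move=> i; rewrite le_max lexx orbT ge_max v0 andbT (le_trans _ (uv i))//.
  by rewrite -normrN ler_norm.
exists (x - y), (fun i => Num.max (u i) 0), (fun i => Num.max (- u i) 0), x, y.
by split=> // i; case: (leP (u i) 0); case: (leP (- u i) 0); lra.
Qed.

(** Such a point mass accounts for the term of index 0 when a series is compared with an
    integral. *)
Lemma has_sum1 (i0 : T) (c : R) : has_sum (fun i => if i == i0 then c else 0) c.
Proof.
suff : has_sum (fun i => if i == i0 then 1 else 0) 1.
  move=> /(has_sumZ c); rewrite mulr1; apply: eq_has_sum => i.
  by case: ifP; rewrite ?mulr1 ?mulr0.
apply: nnsum_has_sum; split=> [i|]; first by case: ifP.
rewrite -(@esum_set1 R T i0 (fun=> 1%:E))// [RHS]esum_mkcond.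
by apply: eq_esum => i _; rewrite in_set1 -[_ == _]/(i == i0); case: (i == i0).
Qed.

End has_sum.

(** * Reindexing, iterated sums and products of families *)

Lemma has_nnsum_support {R : realType} {T T' : choiceType} (e : T -> T')
    (p : T' -> R) a : injective e ->
  (forall j, (forall i, e i != j) -> p j = 0) ->
  has_nnsum (p \o e) a <-> has_nnsum p a.
Proof.
move=> einj p0.
have E : (\esum_(j in [set: T']) (p j)%:E = \esum_(i in [set: T]) (p (e i))%:E)%E.
  rewrite -(@esum_image R T T' setT e (fun j => (p j)%:E)); last first.
    by move=> x y _ _; exact: einj.
  rewrite [RHS]esum_mkcond; apply: eq_esum => j _; case: ifPn => // /negP je.
  rewrite p0// => i; apply/eqP => ij; apply: je; rewrite inE; exists i => //.
split=> -[pge0 pa]; split=> //.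
- move=> j; have [[i <-]|je] := pselect (exists i, e i = j); first exact: pge0.
  by rewrite p0// => i; apply/eqP => ij; apply: je; exists i.
- by rewrite E.
- by move=> i; exact: pge0.
- by rewrite -pa E.
Qed.

Lemma has_sum_support {R : realType} {T T' : choiceType} (e : T -> T')
    (u : T' -> R) a : injective e ->
  (forall j, (forall i, e i != j) -> u j = 0) ->
  has_sum (u \o e) a <-> has_sum u a.
Proof.
move=> einj u0; split=> /has_sum_posneg[b [c [ub uc ->]]].
  exists (fun i => Num.max (u i) 0), (fun i => Num.max (- u i) 0), b, c.
  split=> // [||i]; last by case: (leP (u i) 0); case: (leP (- u i) 0); lra.
  - by apply/(has_nnsum_support _ einj) => // j /u0 ->; rewrite maxxx.
  - by apply/(has_nnsum_support _ einj) => // j /u0 ->; rewrite oppr0 maxxx.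
exists (fun i => Num.max (u (e i)) 0), (fun i => Num.max (- u (e i)) 0), b, c.
split=> // [||i]; last first.
- by case: (leP (u (e i)) 0); case: (leP (- u (e i)) 0); rewrite /=; lra.
- apply/(@has_nnsum_support _ _ _ e (fun i => Num.max (- u i) 0)) => //.
  by move=> j /u0 ->; rewrite oppr0 maxxx.
- apply/(@has_nnsum_support _ _ _ e (fun i => Num.max (u i) 0)) => //.
  by move=> j /u0 ->; rewrite maxxx.
Qed.

Lemma has_sum_reindex {R : realType} {T T' : choiceType} (e : T -> T')
    (u : T' -> R) a : bijective e -> has_sum u a -> has_sum (u \o e) a.
Proof.
move=> [g eK gK] ua; apply/has_sum_support => //; first exact: can_inj eK.
by move=> j /(_ (g j)); rewrite gK eqxx.
Qed.

Lemma has_nnsum_fiber {R : realType} {T T' : choiceType} (p : T * T' -> R) a :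
  has_nnsum p a ->
  exists2 P, (forall i, has_nnsum (fun j => p (i, j)) (P i)) & has_nnsum P a.
Proof.
move=> [p0 pa].
have E : (\esum_(i in [set: T]) \esum_(j in [set: T']) (p (i, j))%:E = a%:E)%E.
  rewrite esum_esum => [|i j _ _]; last by rewrite lee_fin.
  rewrite -pa (_ : _ `*`` _ = [set: T * T']); last by apply/seteqP; split.
  by apply: eq_esum => -[i j].
have in0 i : (0 <= \esum_(j in [set: T']) (p (i, j))%:E)%E.
  by apply: esum_ge0 => j _; rewrite lee_fin.
(* A summable family of extended reals has finite terms, so every inner sum is real. *)
have fin i : \esum_(j in [set: T']) (p (i, j))%:E \is a fin_num.
  have : summable [set: T] (fun i => \esum_(j in [set: T']) (p (i, j))%:E).
    rewrite /summable (eq_esum (b := fun i => \esum_(j in [set: T']) (p (i, j))%:E)).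
      by rewrite E ltry.
    by move=> k _; rewrite gee0_abs.
  move=> /summable_pinfty/(_ i I); rewrite gee0_abs// => lty.
  by rewrite ge0_fin_numE.
exists (fun i => fine (\esum_(j in [set: T']) (p (i, j))%:E)).
  by move=> i; split=> //; rewrite fineK.
split=> [i|]; first exact: fine_ge0.
by rewrite -E; apply: eq_esum => i _; rewrite fineK.
Qed.

(** The fibre sums of [p] and [q] exist by Tonelli, and their difference is [w] by uniqueness of
    sums. *)
Lemma has_sum_fiber {R : realType} {T T' : choiceType} (G : T * T' -> R)
    (w : T -> R) a : has_sum G a ->
  (forall i, has_sum (fun j => G (i, j)) (w i)) -> has_sum w a.
Proof.
move=> [p [q [x [y [px qy Gpq ->]]]]] Gw.
have [P pP Px] := has_nnsum_fiber px; have [Q qQ Qy] := has_nnsum_fiber qy.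
exists P, Q, x, y; split=> // i; apply: (has_sum_inj (Gw i)).
by exists (fun j => p (i, j)), (fun j => q (i, j)), (P i), (Q i); split.
Qed.

Lemma has_nnsum_prod {R : realType} {T T' : choiceType} (p : T -> R)
    (q : T' -> R) a b : has_nnsum p a -> has_nnsum q b ->
  has_nnsum (fun ij => p ij.1 * q ij.2) (a * b).
Proof.
move=> pa qb; split=> [ij|].
  by rewrite mulr_ge0 ?(has_nnsum_term pa) ?(has_nnsum_term qb).
transitivity (\esum_(i in [set: T]) \esum_(j in [set: T']) (p i * q j)%:E)%E.
  rewrite esum_esum => [|i j _ _]; last first.
    by rewrite lee_fin mulr_ge0//; [case: pa|case: qb].
  by rewrite (_ : _ `*`` _ = [set: T * T'])//; apply/seteqP; split.
have [_] := has_nnsumZ (has_nnsum_ge0 qb) pa; rewrite mulrC => <-.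
apply: eq_esum => i _.
by have [_ ->] := has_nnsumZ (has_nnsum_term pa i) qb; rewrite mulrC.
Qed.

(** Expanding (p - q)(p' - q') and sorting by sign leaves a difference of two non-negative
    families. *)
Lemma has_sum_prod {R : realType} {T T' : choiceType} (u : T -> R)
    (v : T' -> R) a b : has_sum u a -> has_sum v b ->
  has_sum (fun ij => u ij.1 * v ij.2) (a * b).
Proof.
move=> [p [q [x [y [px qy upq ->]]]]] [p' [q' [x' [y' [px' qy' vpq ->]]]]].
exists (fun ij => p ij.1 * p' ij.2 + q ij.1 * q' ij.2).
exists (fun ij => p ij.1 * q' ij.2 + q ij.1 * p' ij.2).
exists (x * x' + y * y'), (x * y' + y * x'); split.
- by apply: has_nnsumD; exact: has_nnsum_prod.
- by apply: has_nnsumD; exact: has_nnsum_prod.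
- by move=> ij; rewrite upq vpq; ring.
- by ring.
Qed.

(** * Convolutions over the integers and their moments *)

Section convolution.
Context {R : realType}.
Implicit Types (u v w : int -> R).

Lemma has_sum_antidiag (G : int * int -> R) w a : has_sum G a ->
  (forall m, has_sum (fun n => G (n, m - n)) (w m)) -> has_sum w a.
Proof.
move=> Ga Gw; apply: (@has_sum_fiber _ _ _ (fun mn => G (mn.2, mn.1 - mn.2))) => //.
apply: (@has_sum_reindex _ _ _ (fun mn : int * int => (mn.2, mn.1 - mn.2)) G) Ga.
exists (fun nl : int * int => (nl.1 + nl.2, nl.1)) => -[m n] /=.
  by congr pair; ring.
by congr pair; ring.
Qed.

Lemma has_sum_convolution u v w a b : has_sum u a -> has_sum v b ->
  (forall m, has_sum (fun n => u n * v (m - n)) (w m)) -> has_sum w (a * b).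
Proof. by move=> /has_sum_prod h /h /has_sum_antidiag; exact. Qed.

(** This is Leibniz' rule on Fourier coefficients: on the antidiagonal n + l = m, the power m^k = (n
    + l)^k expands by the binomial formula. *)
Lemma has_sum_moment_convolution u v w (a b : nat -> R) k :
  (forall i, (i <= k)%N -> has_sum (fun n => n%:~R ^+ i * u n) (a i)) ->
  (forall i, (i <= k)%N -> has_sum (fun n => n%:~R ^+ i * v n) (b i)) ->
  (forall m, has_sum (fun n => u n * v (m - n)) (w m)) ->
  has_sum (fun m => m%:~R ^+ k * w m)
    (\sum_(i < k.+1) a (k - i)%N * b i *+ 'C(k, i)).
Proof.
move=> ua vb uvw.
apply: (@has_sum_antidiag (fun nl => (nl.1 + nl.2)%:~R ^+ k * (u nl.1 * v nl.2))).
  have h (i : 'I_k.+1) := has_sumZ ('C(k, i)%:R)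
      (has_sum_prod (ua (k - i)%N (leq_subr _ _)) (vb i (leq_ord i))).
  have := has_sum_sum (index_enum _) h.
  under eq_bigr do rewrite mulr_natl.
  apply: eq_has_sum => -[n l] /=.
  rewrite intrD exprDn mulr_suml; apply: eq_bigr => i _.
  by rewrite -[in RHS]mulr_natl -[RHS]mulrA; congr (_ * _); rewrite mulrACA.
move=> m /=; apply: eq_has_sum (has_sumZ (m%:~R ^+ k) (uvw m)) => n /=.
by have -> : n + (m - n) = m by rewrite addrC subrK.
Qed.

End convolution.

(** * Telescoping sums and hyperbolic functions *)

Section telescoping.
Context {R : realType}.

Lemma has_nnsum_int (p : int -> R) a b :
  has_nnsum (fun n : nat => p n) a -> has_nnsum (fun n => p (Negz n)) b ->
  has_nnsum p (a + b).
Proof.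
pose p1 (i : int) := if i is Posz n then p i else 0.
pose p2 (i : int) := if i is Negz n then p i else 0.
move=> pa pb.
have p1a : has_nnsum p1 a.
  by apply/(@has_nnsum_support _ _ _ Posz) => // [x y []//|[n|//] /(_ n)];
    rewrite ?eqxx.
have p2b : has_nnsum p2 b.
  by apply/(@has_nnsum_support _ _ _ Negz) => // [x y []//|[//|n] /(_ n)];
    rewrite ?eqxx.
by apply: eq_has_nnsum (has_nnsumD p1a p2b) => -[n|n] /=; rewrite ?addr0 ?add0r.
Qed.

Lemma has_nnsum_series (p : nat -> R) a : (forall n, 0 <= p n) ->
  \sum_(0 <= i < n) p i @[n --> \oo] --> a -> has_nnsum p a.
Proof.
move=> p0 pa; split=> //.
rewrite -nneseries_esumT; last by move=> n; rewrite lee_fin.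
apply/cvg_lim => //; under eq_fun do rewrite sumEFin.
exact/cvg_EFin/pa/nearW.
Qed.

(** Monotonicity makes the increments non-negative, so limits of ordinary partial sums on the two
    half-lines suffice. *)
Lemma has_nnsum_telescope (S : int -> R) a b :
  (forall j, S j <= S (j + 1)) ->
  S n%:Z @[n --> \oo] --> b -> S (- n%:Z) @[n --> \oo] --> a ->
  has_nnsum (fun j : int => S (j + 1) - S j) (b - a).
Proof.
move=> Sle Sb Sa; rewrite (_ : b - a = (b - S 0) + (S 0 - a)); last by ring.
apply: has_nnsum_int; apply: has_nnsum_series => [n|].
- by rewrite subr_ge0.
- rewrite (_ : (fun _ => _) = fun n : nat => S n - S 0).
    exact: cvgB Sb (cvg_cst _).
  apply/funext => n; rewrite -(telescope_sumr (fun i : nat => S i))//.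
  by apply: eq_bigr => i _; rewrite -addn1 PoszD.
- by rewrite subr_ge0.
- rewrite (_ : (fun _ => _) = fun n : nat => S 0 - S (- n%:Z)).
    exact: cvgB (cvg_cst _) Sa.
  apply/funext => n.
  (* [Negz i] is -(i + 1), so its increment runs from S(-(i + 1)) to S(-i). *)
  rewrite -[RHS]opprB -[in RHS]oppr0 -(telescope_sumr (fun i : nat => S (- i%:Z)))//.
  rewrite -sumrN; apply: eq_bigr => i _.
  by rewrite opprB NegzE -addn1 PoszD opprD subrK.
Qed.

Lemma bijective_addr_int (m : int) : bijective (fun j : int => j + m).
Proof. by exists (fun j => j - m) => j; rewrite ?addrK ?subrK. Qed.

(** A positive shift is composed of m unit shifts, each contributing [c]; a negative one is, after
    reindexing, the opposite of a positive one. *)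
Lemma has_sum_telescope (S : int -> R) c m :
  has_sum (fun j : int => S (j + 1) - S j) c ->
  has_sum (fun j : int => S (j + m) - S j) (m%:~R * c).
Proof.
move=> Sc.
have pos (n : nat) : has_sum (fun j : int => S (j + n%:Z) - S j) (n%:R * c).
  elim: n => [|n ih].
    by rewrite mul0r; apply: eq_has_sum has_sum0 => j; rewrite addr0 subrr.
  have := has_sumD ih (has_sum_reindex (bijective_addr_int n) Sc).
  rewrite (_ : _ + c = n.+1%:R * c); last by rewrite -natr1 mulrDl mul1r.
  apply: eq_has_sum => j /=.
  have -> : j + n.+1 = j + n%:Z + 1 by rewrite -addn1 PoszD addrA.
  by ring.
case: m => n; first exact: pos.
have := has_sumN (has_sum_reindex (bijective_addr_int (Negz n)) (pos n.+1)).
rewrite NegzE mulrNz mulNr; apply: eq_has_sum => j /=.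
by rewrite subrK opprB.
Qed.

End telescoping.

(** * Hyperbolic functions and the Gudermannian *)

Section hyperbolic.
Context {R : realType}.
Implicit Types x y h : R.

Definition sinh x : R := (expR x - expR (- x)) / 2.
Definition tanh x : R := sinh x / cosh x.

Lemma cosh_ge1 x : 1 <= cosh x.
Proof.
by rewrite /cosh ler_pdivlMr//; have := expR_ge1Dx x; have := expR_ge1Dx (- x); lra.
Qed.

Lemma cosh_gt0 x : 0 < cosh x. Proof. exact: lt_le_trans (cosh_ge1 x). Qed.

Lemma cosh_neq0 x : cosh x != 0. Proof. by rewrite gt_eqF ?cosh_gt0. Qed.

Lemma coshN x : cosh (- x) = cosh x.
Proof. by rewrite /cosh opprK addrC. Qed.

Lemma cosh0 : cosh 0 = 1 :> R.
Proof. by rewrite /cosh oppr0 expR0; field. Qed.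

Lemma sinhN x : sinh (- x) = - sinh x.
Proof. by rewrite /sinh opprK -mulNr opprB. Qed.

Lemma sinh0 : sinh 0 = 0 :> R.
Proof. by rewrite /sinh oppr0 subrr mul0r. Qed.

Lemma sinhD x y : sinh (x + y) = sinh x * cosh y + cosh x * sinh y.
Proof. by rewrite /sinh /cosh opprD !expRD; field. Qed.

Lemma coshD x y : cosh (x + y) = cosh x * cosh y + sinh x * sinh y.
Proof. by rewrite /sinh /cosh opprD !expRD; field. Qed.

Lemma sinhB x y : sinh (x - y) = sinh x * cosh y - cosh x * sinh y.
Proof. by rewrite sinhD coshN sinhN mulrN. Qed.

Lemma coshB x y : cosh (x - y) = cosh x * cosh y - sinh x * sinh y.
Proof. by rewrite coshD coshN sinhN mulrN. Qed.

Lemma cosh2_sinh2 x : cosh x ^+ 2 = 1 + sinh x ^+ 2.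
Proof. by rewrite -[1]cosh0 -(subrr x) coshB; ring. Qed.

Lemma sinh_gt0 x : 0 < x -> 0 < sinh x.
Proof. by move=> x0; rewrite divr_gt0// subr_gt0 ltr_expR; lra. Qed.

Lemma sinh_neq0 x : x != 0 -> sinh x != 0.
Proof.
move=> x0; have [|/sinh_gt0|/eqP] := ltgtP x 0; rewrite ?(negPf x0)//; last first.
  by move=> h; rewrite gt_eqF.
by rewrite -oppr_gt0 => /sinh_gt0; rewrite sinhN oppr_gt0 => h; rewrite lt_eqF.
Qed.

Lemma tanhN x : tanh (- x) = - tanh x.
Proof. by rewrite /tanh sinhN coshN mulNr. Qed.

Lemma sechN x : sech (- x) = sech x :> R.
Proof. by rewrite /sech coshN. Qed.

Lemma sech_gt0 x : 0 < sech x.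
Proof. by rewrite /sech divr_gt0 ?cosh_gt0. Qed.

Lemma sech0 : sech 0 = 1 :> R.
Proof. by rewrite /sech cosh0 divr1. Qed.

(** Read from right to left, this turns a product of two [sech] whose arguments differ by a constant
    into a telescoping difference. *)
Lemma tanhB x y : tanh x - tanh y = sinh (x - y) * (sech x * sech y).
Proof.
by rewrite /tanh /sech sinhB; field; rewrite !cosh_neq0.
Qed.

Lemma ler_cosh x y : 0 <= x -> x <= y -> cosh x <= cosh y.
Proof.
have sinh_ge0 z : 0 <= z -> 0 <= sinh z.
  by rewrite le_eqVlt => /predU1P[<-|/sinh_gt0/ltW//]; rewrite sinh0.
move=> x0 xy; rewrite -(subrK x y) coshD.
rewrite (le_trans (y := cosh (y - x) * cosh x))//.
  by rewrite ler_peMl ?cosh_ge1// ltW ?cosh_gt0.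
by rewrite lerDl mulr_ge0// sinh_ge0// subr_ge0.
Qed.

Lemma ler_sech x y : 0 <= x -> x <= y -> sech y <= sech x.
Proof.
by move=> x0 xy; rewrite /sech !div1r lef_pV2 ?posrE ?cosh_gt0// ler_cosh.
Qed.

Lemma cvgy_affine y c : 0 < y -> (n%:R * y + c @[n --> \oo] --> +oo).
Proof.
move=> y0; apply/cvgryPge => A; near=> n.
rewrite -lerBlDr -ler_pdivrMr//; near: n; exact: nbhs_infty_ger.
Unshelve. all: by end_near. Qed.

(** The gap [1 - tanh x = expR (- x) * sech x] lies between 0 and [expR (- x)]. *)
Lemma cvgy_tanh : tanh x @[x --> +oo] --> (1 : R).
Proof.
have h : (fun x => 1 - expR (- x)) x @[x --> +oo] --> (1 : R).
  by rewrite -[X in _ --> X]subr0; apply: cvgB; [exact: cvg_cst|exact: cvgr_expR].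
apply: (squeeze_cvgr _ h (cvg_cst _)).
apply: nearW => x; have e : 1 - tanh x = expR (- x) * sech x.
  by rewrite /tanh /sech -[1](@divff _ (cosh x)) ?cosh_neq0// -mulrBl {1}/cosh /sinh;
    field; rewrite cosh_neq0.
have s1 : sech x <= 1 by rewrite /sech div1r invf_le1 ?cosh_gt0// cosh_ge1.
have := expR_gt0 (- x); have := sech_gt0 x; move: e s1; nra.
Qed.

(** The factor 2 is the total increase of [tanh] from -1 to 1. *)
Lemma has_sum_tanh y c (m : int) : 0 < y ->
  has_sum (fun j : int => tanh ((j + m)%:~R * y + c) - tanh (j%:~R * y + c))
    (m%:~R * 2).
Proof.
move=> y0; pose S (j : int) : R := tanh (j%:~R * y + c).
apply: (@has_sum_telescope _ S 2 m); apply: nnsum_has_sum.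
have -> : 2 = 1 - (- 1) :> R by rewrite opprK.
apply: has_nnsum_telescope => [j||].
- rewrite /S -subr_ge0 tanhB; apply/ltW.
  apply: mulr_gt0; last by rewrite mulr_gt0 ?sech_gt0.
  by apply: sinh_gt0; rewrite intrD; lra.
- apply: (cvg_comp _ _ (cvgy_affine c y0)); exact: cvgy_tanh.
- rewrite (_ : (fun _ => _) = fun n : nat => - tanh (n%:R * y - c)).
    by apply: cvgN; apply: (cvg_comp _ _ (cvgy_affine (- c) y0)); exact: cvgy_tanh.
  by apply/funext => n; rewrite /S -tanhN opprB mulrNz mulNr addrC.
Qed.

Lemma cvgy_sinh : sinh x @[x --> +oo] --> +oo.
Proof.
apply: (@ger_cvgy _ _ _ _ (fun x => 2^-1 * x)).
  near=> x; rewrite mulrC /sinh ler_pM2r//.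
  have : expR (- x) <= 1 by rewrite expR_le1 oppr_le0.
  by have := expR_ge1Dx x; lra.
by apply: gt0_cvgMry; [|exact: cvg_id].
Unshelve. all: by end_near. Qed.

Lemma is_derive_sinh x : is_derive x 1 sinh (cosh x).
Proof.
pose e := fun y => (expR y - expR (- y)) * 2^-1.
rewrite (_ : sinh = e)//.
by apply: is_derive_eq; rewrite /cosh !scaler0 add0r mulrN1 opprK mulrC.
Qed.

(** The Gudermannian function, the primitive of [sech] that vanishes at 0. *)
Definition gd x : R := atan (sinh x).

Lemma gdN x : gd (- x) = - gd x.
Proof. by rewrite /gd sinhN atanN. Qed.

Lemma is_derive_gd x : is_derive x 1 gd (sech x).
Proof.
have ds := is_derive_sinh x.
have := @is_derive1_comp R atan sinh x _ _ (is_derive1_atan (sinh x)) ds.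
by move=> h; apply: is_derive_eq; rewrite -cosh2_sinh2 /sech; field; rewrite cosh_neq0.
Qed.

Lemma gd_mvt x y : x < y ->
  exists2 c, x < c < y & gd y - gd x = sech c * (y - x).
Proof.
move=> xy; have [|c] := @MVT R gd sech x y xy (fun z _ => is_derive_gd z).
  by apply: derivable_within_continuous => z _; have [] := is_derive_gd z.
by rewrite in_itv => xcy ->; exists c.
Qed.

(** The mean value theorem applies, and [sech] decreases on the non-negative half-line. *)
Lemma gd_increment x y : 0 <= x -> x < y ->
  (y - x) * sech y <= gd y - gd x <= (y - x) * sech x.
Proof.
move=> x0 xy; have [c /andP[xc cy] ->] := gd_mvt xy.
have yx : 0 <= y - x by rewrite subr_ge0 ltW.
rewrite ![(y - x) * _]mulrC !ler_wpM2r//=.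
  by rewrite ler_sech// ltW.
by rewrite ler_sech// ?ltW// (le_lt_trans x0).
Qed.

Lemma has_nnsum_gd h : 0 < h ->
  has_nnsum (fun j : int => gd ((j + 1)%:~R * h) - gd (j%:~R * h)) pi.
Proof.
move=> h0; pose S (j : int) : R := gd (j%:~R * h).
have -> : pi = pi / 2 - - (pi / 2) :> R by field.
have lim : gd (n%:R * h) @[n --> \oo] --> pi / 2.
  have h1 := cvgy_affine 0 h0.
  under eq_fun do rewrite -[X in gd X]addr0.
  apply: (cvg_comp _ _ h1).
  apply: (cvg_comp _ _ cvgy_sinh); exact: cvgy_atan.
apply: (@has_nnsum_telescope _ S) => [j||].
- have [|c _ e] := @gd_mvt (j%:~R * h) ((j + 1)%:~R * h).
    by rewrite ltr_pM2r// ltr_int ltrDl.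
  by rewrite -subr_ge0 /S e -mulrBl -intrB addrC addKr mul1r mulr_ge0// ltW ?sech_gt0.
- exact: lim.
- rewrite (_ : (fun _ => _) = fun n : nat => - gd (n%:R * h)).
    exact: cvgN lim.
  by apply/funext => n; rewrite /S mulrNz mulNr gdN.
Qed.

End hyperbolic.

(** * Convolutions of hyperbolic secants *)

Lemma bijective_opp_int : bijective (fun n : int => - n).
Proof. by exists (fun n => - n) => n; rewrite opprK. Qed.

Lemma bijective_subr_int (m : int) : bijective (fun n : int => m - n).
Proof. by exists (fun n => m - n) => n; rewrite opprB addrC subrK. Qed.

Section sech_series.
Context {R : realType}.
Implicit Types (h : R) (m n : int).

Definition sechz h n : R := sech (n%:~R * h).
(** [esechz], [osechz] and [ocschz] are the families f, c and s. *)
Definition esechz h n : R := if (n %% 2)%Z == 0 then sechz h n else 0.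
Definition osechz h n : R := if (n %% 2)%Z == 1 then sechz h n else 0.
Definition ocschz h n : R := if (n %% 2)%Z == 1 then (sinh (n%:~R * h))^-1 else 0.

Lemma sechzN h n : sechz h (- n) = sechz h n.
Proof. by rewrite /sechz mulrNz mulNr sechN. Qed.

Lemma sechz_gt0 h n : 0 < sechz h n. Proof. exact: sech_gt0. Qed.

(** This is the integral of [sech] over the cell from j h to (j + 1) h. *)
Let D h (j : int) : R := gd ((j + 1)%:~R * h) - gd (j%:~R * h).

Let DN h j : D h (- (j + 1)) = D h j.
Proof.
rewrite /D opprD addrK -opprD !mulrNz !mulNr !gdN.
by rewrite opprK addrC.
Qed.

Let D_ge h j : 0 < h -> 0 <= j -> h * sechz h (j + 1) <= D h j <= h * sechz h j.
Proof.
move=> h0 j0; have j0' : 0 <= j%:~R * h by rewrite mulr_ge0 ?ler0z// ltW.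
have jj : j%:~R * h < (j + 1)%:~R * h by rewrite ltr_pM2r// ltr_int ltrDl.
have := gd_increment j0' jj; rewrite -mulrBl -intrB.
by rewrite (_ : j + 1 - j = 1) ?mul1r// addrC addKr.
Qed.

Let D_le h j : 0 < h -> j < 0 -> h * sechz h j <= D h j <= h * sechz h (j + 1).
Proof.
move=> h0 j0; have : 0 <= - (j + 1) by lia.
move=> /(D_ge h0); rewrite sechzN DN.
by rewrite (_ : - (j + 1) + 1 = - j) ?sechzN// opprD subrK.
Qed.

Lemma sechz_summable h : 0 < h -> exists a, has_sum (sechz h) a.
Proof.
move=> h0.
have Dpi : has_sum (D h) pi by exact/nnsum_has_sum/has_nnsum_gd.
have D0 : forall j, 0 <= D h j := has_nnsum_term (has_nnsum_gd h0).
(* The term of index 0 is bounded by [h], one with j < 0 by the cell to its right, one with j > 0 by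
   the cell to its left. *)
have := has_sumD (has_sum1 0 h)
  (has_sumD Dpi (has_sum_reindex (bijective_addr_int (-1)) Dpi)).
have dom (j : int) : `|h * sechz h j| <=
    (if j == 0 then h else 0) + (D h j + (D h \o (fun i => i + -1)) j).
  rewrite ger0_norm; last by rewrite mulr_ge0 ?ltW// sechz_gt0.
  have D1 := D0 j; have D2 := D0 (j + -1); rewrite /=.
  have [j0|j0|->] := ltgtP j 0.
  - by have /andP[] := D_le h0 j0; lra.
  - have j1 : 0 <= j + -1 by lia.
    by have /andP[] := D_ge h0 j1; rewrite subrK; lra.
  - have -> : h * sechz h 0 = h by rewrite /sechz mul0r sech0 mulr1.
    by have := D0 0; have := D0 (0 + -1); lra.
move=> /(has_sum_dominated dom)[a /(has_sumZ h^-1) ha].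
exists (h^-1 * a); apply: eq_has_sum ha => j.
by rewrite mulKf// gt_eqF.
Qed.

(** This is A(h), which for h > 0 is theta_3(q)^2 with q = exp(-h); 0 is the default value for a
    family without a sum. *)
Definition sech_sum h : R := xget 0 [set a | has_sum (sechz h) a].

Lemma has_sum_sechz h : 0 < h -> has_sum (sechz h) (sech_sum h).
Proof.
move=> /sechz_summable[a ha].
exact: (@xgetPex _ 0 [set a | has_sum (sechz h) a] (ex_intro _ a ha)).
Qed.

Lemma sech_sum_ge1 h : 0 < h -> 1 <= sech_sum h.
Proof.
move=> h0; apply: has_sum_le (has_sum1 0 1) (has_sum_sechz h0) => n.
by case: eqP => [->|_]; [rewrite /sechz mul0r sech0|rewrite ltW ?sechz_gt0].
Qed.

Let dominated_sechz h (u : int -> R) : 0 < h -> (forall n, `|u n| <= sechz h n) ->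
  exists a, has_sum u a.
Proof. by move=> h0 hu; exact: has_sum_dominated hu (has_sum_sechz h0). Qed.

Let restrict_summable h (P : pred int) : 0 < h ->
  exists a, has_sum (fun n => if P n then sechz h n else 0) a.
Proof.
move=> h0; apply: (@dominated_sechz h) => // n.
by case: ifP => _; rewrite ?normr0 ?ger0_norm// ltW// sechz_gt0.
Qed.

(** [h * sech_sum h] is a Riemann sum of the unimodal function [sech], whose integral is [pi]; the
    error is at most the term of index 0, equal to [h]. *)
Lemma sech_sum_pi h : 0 < h -> pi - h <= h * sech_sum h <= pi + h.
Proof.
move=> h0; have Sh := has_sum_sechz h0.
have Dpi : has_sum (D h) pi by exact/nnsum_has_sum/has_nnsum_gd.
apply/andP; split.
  (* 0 is counted twice here, and not at all in the lower bound below. *)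
  have [a ha] := restrict_summable (fun n => 0 <= n) h0.
  have [b hb] := restrict_summable (fun n => n <= 0) h0.
  have e : a + b = sech_sum h + 1.
    apply: has_sum_inj (has_sumD ha hb) _.
    apply: eq_has_sum (has_sumD Sh (has_sum1 0 1)) => n /=.
    by case: ltgtP => [||<-]; rewrite ?addr0 ?add0r// /sechz mul0r sech0.
  (* On the cell of index j the maximum of [sech] is at the left end for j >= 0 and at the right end
     for j < 0, hence the shift. *)
  have hb1 := has_sum_reindex (bijective_addr_int 1) hb.
  have : pi <= h * (a + b).
    apply: has_sum_le Dpi (has_sumZ h (has_sumD ha hb1)) => j /=.
    have [j0|j0] := leP 0 j.
      rewrite (_ : j + 1 <= 0 = false) ?addr0; last by lia.
      by have /andP[] := D_ge h0 j0.
    rewrite (_ : j + 1 <= 0) ?add0r; last by lia.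
    by have /andP[] := D_le h0 j0.
  by rewrite e mulrDr mulr1; lra.
have [a ha] := restrict_summable (fun n => 0 < n) h0.
have [b hb] := restrict_summable (fun n => n < 0) h0.
have e : a + b = sech_sum h - 1.
  apply: has_sum_inj (has_sumD ha hb) _.
  apply: eq_has_sum (has_sumB Sh (has_sum1 0 1)) => n /=.
  by case: ltgtP => [||<-]; rewrite ?subr0 ?addr0 ?add0r// /sechz mul0r sech0 subrr.
have ha1 := has_sum_reindex (bijective_addr_int 1) ha.
have : h * (a + b) <= pi.
  apply: has_sum_le (has_sumZ h (has_sumD ha1 hb)) Dpi => j /=.
  have [j0|j0] := leP 0 j.
    rewrite (_ : 0 < j + 1) ?addr0; last by lia.
    by have /andP[] := D_ge h0 j0.
  rewrite (_ : 0 < j + 1 = false) ?add0r; last by lia.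
  by have /andP[] := D_le h0 j0.
by rewrite e mulrBr mulr1; lra.
Qed.

Lemma has_sum_double (u : int -> R) a :
  (forall n, (n %% 2)%Z = 1 -> u n = 0) ->
  has_sum (fun j => u (2 * j)) a -> has_sum u a.
Proof.
move=> u0 ua; apply/(@has_sum_support _ _ _ (fun j : int => 2 * j)) => //.
  by move=> i j; lia.
by move=> n hn; apply: u0; have := hn (n %/ 2)%Z; lia.
Qed.

Lemma has_sum_double1 (u : int -> R) a :
  (forall n, (n %% 2)%Z = 0 -> u n = 0) ->
  has_sum (fun j => u (2 * j + 1)) a -> has_sum u a.
Proof.
move=> u0 ua; apply/(@has_sum_support _ _ _ (fun j : int => 2 * j + 1)) => //.
  by move=> i j; lia.
by move=> n hn; apply: u0; have := hn (n %/ 2)%Z; lia.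
Qed.

(** The even terms for [h] are all the terms for [2 * h]. *)
Lemma has_sum_esechz h : 0 < h -> has_sum (esechz h) (sech_sum (2 * h)).
Proof.
move=> h0; apply: has_sum_double => [n n1|]; first by rewrite /esechz n1.
have h20 : 0 < 2 * h by lra.
apply: eq_has_sum (has_sum_sechz h20) => j.
rewrite /esechz /sechz (_ : (2 * j %% 2)%Z = 0); last by lia.
by rewrite eqxx intrM; congr sech; ring.
Qed.

Definition osech_sum h := sech_sum h - sech_sum (2 * h).

Lemma has_sum_osechz h : 0 < h -> has_sum (osechz h) (osech_sum h).
Proof.
move=> h0; apply: eq_has_sum (has_sumB (has_sum_sechz h0) (has_sum_esechz h0)) => n.
rewrite /esechz /osechz; case: eqP => [->|n0]; first by rewrite subrr.
by rewrite (_ : (n %% 2)%Z = 1) ?subr0//; lia.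
Qed.

(** By [tanhB] each product is (tanh(n h) - tanh((n - m) h)) / sinh(m h), a difference over m
    steps. *)
Lemma has_sum_sechz_sechz h m : 0 < h -> m != 0 ->
  has_sum (fun n => sechz h n * sechz h (m - n)) (m%:~R * 2 / sinh (m%:~R * h)).
Proof.
move=> h0 m0; have sm : sinh (m%:~R * h) != 0.
  by rewrite sinh_neq0// mulf_neq0 ?intr_eq0// gt_eqF.
have := has_sumZ (sinh (m%:~R * h))^-1 (has_sum_tanh (- (m%:~R * h)) m h0).
rewrite [X in has_sum _ X]mulrC; apply: eq_has_sum => n.
rewrite intrD mulrDl addrK -(sechzN h (m - n)) opprB tanhB.
rewrite (_ : n%:~R * h - (n%:~R * h - m%:~R * h) = m%:~R * h); last by ring.
by rewrite mulKf// /sechz intrB mulrBl.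
Qed.

Let sechz_le1 h n : sechz h n <= 1.
Proof. by rewrite /sechz /sech div1r invf_le1 ?cosh_gt0// cosh_ge1. Qed.

(* For odd m, the involution n |-> m - n exchanges even and odd n: the sum is half
   of the sum over all n. *)
Lemma has_sum_esechz_osechz h m : 0 < h ->
  has_sum (fun n => esechz h n * osechz h (m - n))
    (if (m %% 2)%Z == 1 then m%:~R / sinh (m%:~R * h) else 0).
Proof.
move=> h0; case: eqP => m1; last first.
  apply: eq_has_sum has_sum0 => n; rewrite /esechz /osechz.
  case: eqP => [n0|_]; last by rewrite mul0r.
  by rewrite (_ : ((m - n) %% 2)%Z == 1 = false) ?mulr0//; lia.
have [a ha] : exists a, has_sum (fun n => esechz h n * osechz h (m - n)) a.
  apply: (@dominated_sechz h) => // n; rewrite /esechz /osechz.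
  case: ifP => _; last by rewrite mul0r normr0 ltW// sechz_gt0.
  case: ifP => _; last by rewrite mulr0 normr0 ltW// sechz_gt0.
  rewrite ger0_norm; last by rewrite mulr_ge0// ltW// sechz_gt0.
  by rewrite ler_piMr// ltW// sechz_gt0.
have hb := has_sum_reindex (bijective_subr_int m) ha.
have m0 : m != 0 by lia.
have : a + a = m%:~R * 2 / sinh (m%:~R * h).
  apply: has_sum_inj (has_sum_sechz_sechz h0 m0).
  apply: eq_has_sum (has_sumD ha hb) => n /=.
  rewrite (_ : m - (m - n) = n) /esechz /osechz; last by rewrite opprB addrC subrK.
  have [n0|n0] := eqVneq (n %% 2)%Z 0.
    rewrite (_ : ((m - n) %% 2)%Z = 1) ?eqxx; last by lia.
    by rewrite n0 /= mul0r addr0.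
  rewrite (_ : ((m - n) %% 2)%Z = 0) ?eqxx; last by lia.
  by rewrite (_ : (n %% 2)%Z = 1) ?mulr0 ?add0r 1?mulrC//; lia.
rewrite mulrAC => e; suff <- : a = m%:~R / sinh (m%:~R * h) by [].
by lra.
Qed.

Lemma has_sum_esechz_osechz_ocschz h m : 0 < h ->
  has_sum (fun n => esechz h n * osechz h (m - n)) (m%:~R * ocschz h m).
Proof.
move=> h0; have := has_sum_esechz_osechz m h0; rewrite /ocschz.
by case: ifP; rewrite ?mulr0.
Qed.

(** Summing the convolution f * c over m gives the product of the two sums. This yields the
    summability of [ocschz] and the right side of [osech_sum_sqr]. *)
Lemma has_sum_mul_ocschz h : 0 < h ->
  has_sum (fun m => m%:~R * ocschz h m) (sech_sum (2 * h) * osech_sum h).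
Proof.
move=> h0.
apply: has_sum_convolution (has_sum_esechz h0) (has_sum_osechz h0) _ => m.
exact: has_sum_esechz_osechz_ocschz.
Qed.

Lemma ocschzN h n : ocschz h (- n) = - ocschz h n.
Proof.
rewrite /ocschz mulrNz mulNr sinhN invrN.
have [n1|n1] := eqVneq (n %% 2)%Z 1.
  by rewrite (_ : (- n %% 2)%Z = 1)//; lia.
by rewrite (_ : (- n %% 2)%Z == 1 = false) ?oppr0//; lia.
Qed.

(** Since [ocschz] is odd and supported on indices with [1 <= |m|], it is dominated by the
    non-negative family [m * ocschz h m]. *)
Lemma ocschz_summable h : 0 < h -> exists a, has_sum (ocschz h) a.
Proof.
move=> h0; apply: has_sum_dominated (has_sum_mul_ocschz h0) => m.
have pos k : 0 <= k -> `|ocschz h k| <= k%:~R * ocschz h k.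
  rewrite /ocschz le_eqVlt => /predU1P[<-|k0]; first by rewrite mul0r normr0.
  case: ifP => _; last by rewrite mulr0 normr0.
  have s0 : 0 <= (sinh (k%:~R * h))^-1.
    by rewrite invr_ge0 ltW// sinh_gt0// mulr_gt0// ltr0z.
  by rewrite ger0_norm// ler_peMl// ler1z.
have [/pos//|m0] := leP 0 m.
have /pos : 0 <= - m by lia.
by rewrite ocschzN normrN mulrNz mulrNN.
Qed.

(* Adding the terms of indices n and - n replaces 1 / sinh (n h) by
   2 sinh (m h) times a product of two values of sech. *)
Lemma has_sum_ocschz_sechz h m : 0 < h ->
  has_sum (fun n => ocschz h n * sechz h (m - n)) (m%:~R * sechz h m).
Proof.
move=> h0; have [c hc] := ocschz_summable h0.
have [a ha] : exists a, has_sum (fun n => ocschz h n * sechz h (m - n)) a.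
  have [p [q [x [y [px qy spq _]]]]] := hc.
  apply: (@has_sum_dominated _ _ _ (fun n => p n + q n) (x + y)); last first.
    exact/nnsum_has_sum/has_nnsumD.
  move=> n; rewrite normrM (ger0_norm (ltW (sechz_gt0 _ _))).
  rewrite (le_trans (ler_piMr _ (sechz_le1 _ _)))// spq.
  have := has_nnsum_term px n; have := has_nnsum_term qy n.
  by move=> q0 p0; rewrite (le_trans (ler_normB _ _))// !ger0_norm.
have hb := has_sum_reindex bijective_opp_int ha.
have h20 : 0 < 2 * h by lra.
have : a + a = (m%:~R * 2) * sechz h m.
  apply: has_sum_inj (has_sumD ha hb) _.
  apply: has_sum_double1 => [n n0|] /=.
    by rewrite ocschzN /ocschz n0 /= oppr0 !mul0r addr0.
  (* With n = 2 j + 1, this step and offset make the shift by m move the argument from (n - m) h to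
     (n + m) h. *)
  have := has_sumZ (sechz h m) (has_sum_tanh (h - m%:~R * h) m h20).
  rewrite [X in has_sum _ X]mulrC; apply: eq_has_sum => j /=.
  rewrite ocschzN; set n := 2 * j + 1.
  have -> : (j + m)%:~R * (2 * h) + (h - m%:~R * h) = n%:~R * h + m%:~R * h.
    by rewrite /n !intrD intrM; ring.
  have -> : j%:~R * (2 * h) + (h - m%:~R * h) = n%:~R * h - m%:~R * h.
    by rewrite /n !intrD intrM; ring.
  have n1 : (n %% 2)%Z = 1 by rewrite /n; lia.
  have sn : sinh (n%:~R * h) != 0.
    by rewrite sinh_neq0// mulf_neq0 ?intr_eq0// ?(gt_eqF h0)//; lia.
  have -> : sechz h (m - n) = sech (n%:~R * h - m%:~R * h).
    by rewrite -sechzN opprB /sechz intrB mulrBl.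
  have -> : sechz h (m - - n) = sech (n%:~R * h + m%:~R * h).
    by rewrite opprK addrC /sechz intrD mulrDl.
  rewrite /ocschz n1 eqxx /sechz.
  move: (n%:~R * h) (m%:~R * h) sn => x y sx.
  have cp := cosh_neq0 (x + y); have cm := cosh_neq0 (x - y); have cy := cosh_neq0 y.
  rewrite tanhB (_ : x + y - (x - y) = y + y) ?sinhD; last by ring.
  rewrite /sech; move: cp cm; rewrite !coshB !coshD => cp cm.
  by field; rewrite sx cp cm cy.
rewrite mulrAC => e; suff <- : a = m%:~R * sechz h m by [].
by lra.
Qed.

(** Only odd n contribute, so the telescoping has step [2 * h] and m / 2 shifts. *)
Lemma has_sum_osechz_osechz h m : 0 < h -> m != 0 -> (m %% 2)%Z = 0 ->
  has_sum (fun n => osechz h n * osechz h (m - n)) (m%:~R / sinh (m%:~R * h)).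
Proof.
move=> h0 m0 m2; have sm : sinh (m%:~R * h) != 0.
  by rewrite sinh_neq0// mulf_neq0 ?intr_eq0// gt_eqF.
have h20 : 0 < 2 * h by lra.
apply: has_sum_double1 => [n n0|]; first by rewrite /osechz n0 mul0r.
have := has_sumZ (sinh (m%:~R * h))^-1 (has_sum_tanh (h - m%:~R * h) (m %/ 2)%Z h20).
have e : m%:~R = (m %/ 2)%Z%:~R * 2 :> R.
  by rewrite {1}(divz_eq m 2) m2 addr0 intrM.
rewrite -e [X in has_sum _ X]mulrC; apply: eq_has_sum => j.
set n := 2 * j + 1.
have -> : (j + (m %/ 2)%Z)%:~R * (2 * h) + (h - m%:~R * h) = n%:~R * h.
  by rewrite /n !intrD intrM e; ring.
have -> : j%:~R * (2 * h) + (h - m%:~R * h) = n%:~R * h - m%:~R * h.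
  by rewrite /n !intrD intrM; ring.
have n1 : (n %% 2)%Z = 1 by rewrite /n; lia.
have l1 : ((m - n) %% 2)%Z = 1 by lia.
rewrite /osechz n1 l1 eqxx.
rewrite -(sechzN h (m - n)) opprB tanhB.
rewrite (_ : n%:~R * h - (n%:~R * h - m%:~R * h) = m%:~R * h); last by ring.
by rewrite mulKf// /sechz intrB mulrBl.
Qed.

(** The square is summed along antidiagonals; those with m = 2 modulo 4 reproduce the family n s(n)
    for [2 * h]. *)
Lemma osech_sum_sqr h : 0 < h ->
  osech_sum h ^+ 2 = 4 * (sech_sum (4 * h) * osech_sum (2 * h)).
Proof.
move=> h0; have hc := has_sum_osechz h0.
(* The sum of e vanishes by oddness, and e n * e l is +/- osechz n * osechz l
   according to n + l mod 4: adding it keeps only the pairs with n + l = 2 mod 4. *)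
pose e (n : int) : R := if (n %% 4)%Z == 1 then sechz h n
  else if (n %% 4)%Z == 3 then - sechz h n else 0.
have [a ea] : exists a, has_sum e a.
  apply: (@dominated_sechz h) => // n; rewrite /e.
  by do 2?case: ifP => _; rewrite ?normrN ?normr0 ?ger0_norm// ltW// sechz_gt0.
have a0 : a = 0.
  have : a = - a; last by lra.
  apply: has_sum_inj (has_sum_reindex bijective_opp_int ea) _.
  apply: eq_has_sum (has_sumN ea) => n /=; rewrite /e sechzN.
  have [n1|n1] := eqVneq (n %% 4)%Z 1.
    by rewrite (_ : (- n %% 4)%Z = 3)//; lia.
  have [n3|n3] := eqVneq (n %% 4)%Z 3.
    by rewrite (_ : (- n %% 4)%Z = 1) ?opprK//; lia.
  have -> : (- n %% 4)%Z == 1 = false by lia.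
  have -> : (- n %% 4)%Z == 3 = false by lia.
  by rewrite oppr0.
rewrite {}a0 in ea.
have sq : has_sum (fun m => if (m %% 4)%Z == 2 then 2 * (m%:~R / sinh (m%:~R * h))
    else 0) (osech_sum h ^+ 2).
  have := has_sumD (has_sum_prod hc hc) (has_sum_prod ea ea).
  rewrite mul0r addr0 -expr2 => /has_sum_antidiag; apply => m /=.
  have [m2|m2] := eqVneq (m %% 4)%Z 2.
    have m0 : m != 0 by lia. have me : (m %% 2)%Z = 0 by lia.
    apply: eq_has_sum (has_sumZ 2 (has_sum_osechz_osechz h0 m0 me)) => n.
    rewrite /osechz /e; have [n1|n1] := eqVneq (n %% 2)%Z 1; last first.
      have -> : (n %% 4)%Z == 1 = false by lia.
      have -> : (n %% 4)%Z == 3 = false by lia.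
      by rewrite !mul0r addr0 mulr0.
    rewrite (_ : ((m - n) %% 2)%Z = 1) ?eqxx; last by lia.
    have [n4|n4] := eqVneq (n %% 4)%Z 1.
      by rewrite (_ : ((m - n) %% 4)%Z = 1) ?eqxx; [ring|lia].
    have n3 : (n %% 4)%Z = 3 by lia.
    have l3 : ((m - n) %% 4)%Z = 3 by lia.
    by rewrite n3 l3 /=; ring.
  apply: eq_has_sum has_sum0 => n.
  rewrite /osechz /e; have [n1|n1] := eqVneq (n %% 2)%Z 1; last first.
    have -> : (n %% 4)%Z == 1 = false by lia.
    have -> : (n %% 4)%Z == 3 = false by lia.
    by rewrite !mul0r addr0.
  have [l1|l1] := eqVneq ((m - n) %% 2)%Z 1; last first.
    have -> : ((m - n) %% 4)%Z == 1 = false by lia.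
    have -> : ((m - n) %% 4)%Z == 3 = false by lia.
    by rewrite !mulr0 addr0.
  have [n4|n4] := eqVneq (n %% 4)%Z 1.
    rewrite (_ : ((m - n) %% 4)%Z = 3) /=; last by lia.
    by ring.
  have n3 : (n %% 4)%Z = 3 by lia.
  have l3 : ((m - n) %% 4)%Z = 1 by lia.
  by rewrite n3 l3 /=; ring.
have h20 : 0 < 2 * h by lra.
(* Writing m = 2 j with j odd, 2 m / sinh(m h) is four times [j * ocschz (2 * h) j]. *)
apply: has_sum_inj sq _; apply: has_sum_double => [n n1|].
  by rewrite ifF//; lia.
have := has_sumZ 4 (has_sum_mul_ocschz h20).
have -> : 2 * (2 * h) = 4 * h by ring.
apply: eq_has_sum => j; rewrite /ocschz.
have [j1|j1] := eqVneq (j %% 2)%Z 1; last first.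
  have -> : ((2 * j) %% 4)%Z == 2 = false by lia.
  by rewrite !mulr0.
have -> : ((2 * j) %% 4)%Z = 2 by lia.
rewrite eqxx intrM (_ : j%:~R * (2 * h) = 2 * j%:~R * h); ring.
Qed.

End sech_series.

(** * The arithmetic-geometric mean *)

Section agm.
Context {R : realType}.
Implicit Types (a b : R^nat).

(** The geometric mean is given by its square, which determines it since [b] is non-negative. *)
Definition agm_iteration a b := forall n, [/\ 0 < a n, 0 <= b n,
  a n.+1 = (a n + b n) / 2 & b n.+1 ^+ 2 = a n * b n].

(** With equal first terms, a larger second term would force a strictly larger limit. *)
Lemma agm_limit_le a b a' b' : agm_iteration a b -> agm_iteration a' b' ->
  a 0%N = a' 0%N -> a @ \oo --> (1 : R) -> a' @ \oo --> (1 : R) ->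
  b 0%N <= b' 0%N.
Proof.
move=> ab ab' a00 a1 a'1; rewrite leNgt; apply/negP => bb.
have [a0 b0 aS bS] := ab 0%N; have [a'0 b'0 a'S b'S] := ab' 0%N.
have [a1_gt0 b1_ge0 _ _] := ab 1%N; have [a'1_gt0 b'1_ge0 _ _] := ab' 1%N.
have aa1 : a' 1%N < a 1%N by rewrite aS a'S a00; lra.
have bb1 : b' 1%N < b 1%N.
  by rewrite -(@ltr_pXn2r _ 2)// ?nnegrE// bS b'S -a00 ltr_pM2l.
(* After one step both terms are larger by a common factor k > 1, which persists
   by homogeneity. *)
pose k := Num.min (a 1%N / a' 1%N) ((b 1%N + 1) / (b' 1%N + 1)).
have k1 : 1 < k by rewrite lt_min !ltr_pdivlMr ?mul1r//; lra.
have k0 : 0 < k by lra.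
have kab n : k * a' n.+1 <= a n.+1 /\ k * b' n.+1 <= b n.+1.
  elim: n => [|n [iha ihb]].
    split; first by rewrite -ler_pdivlMr// ge_min lexx.
    (* As [b' 1] may vanish, [k] uses a shifted quotient; it still works because [b' 1 < b 1]. *)
    apply: (le_trans (y := (b 1%N + 1) / (b' 1%N + 1) * b' 1%N)).
      by rewrite ler_wpM2r// ge_min lexx orbT.
    by rewrite mulrAC ler_pdivrMr; nra.
  have [an bn -> bSn] := ab n.+1; have [a'n b'n -> b'Sn] := ab' n.+1.
  split; first by lra.
  have [_ bn2 _ _] := ab n.+2; have [_ b'n2 _ _] := ab' n.+2.
  rewrite -(@ler_pXn2r _ 2)// ?nnegrE// ?mulr_ge0 ?(ltW k0)//.
  rewrite exprMn bSn b'Sn expr2 mulrACA.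
  by rewrite ler_pM// mulr_ge0// ltW.
have : k * 1 <= 1.
  apply: (@ler_cvg_to _ \oo _ _ (fun n => k * a' n.+1) (fun n => a n.+1)).
  - have a'S1 : a' n.+1 @[n --> \oo] --> (1 : R) by move: a'1; rewrite -cvg_shiftS.
    exact: cvgMl_tmp a'S1.
  - by move: a1; rewrite -cvg_shiftS.
  - by apply: nearW => n; have [] := kab n.
by lra.
Qed.

Lemma agm_limit_inj a b a' b' : agm_iteration a b -> agm_iteration a' b' ->
  a 0%N = a' 0%N -> a @ \oo --> (1 : R) -> a' @ \oo --> (1 : R) ->
  b 0%N = b' 0%N.
Proof.
move=> ab ab' a00 a1 a'1; apply/eqP; rewrite eq_le.
rewrite (agm_limit_le ab ab' a00 a1 a'1).
by rewrite (agm_limit_le ab' ab (esym a00) a'1 a1).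
Qed.

End agm.

(** * The two arithmetic-geometric mean iterations starting at A(pi) *)

Section lemniscatic.
Context {R : realType}.
Let A : R -> R := sech_sum.

Let A_gt0 h : 0 < h -> 0 < A h.
Proof. by move=> /sech_sum_ge1; exact: lt_le_trans. Qed.

Let A_rel h : 0 < h ->
  (A h - A (2 * h)) ^+ 2 = 4 * (A (4 * h) * (A (2 * h) - A (4 * h))).
Proof.
move=> /osech_sum_sqr; rewrite /osech_sum -/A.
by rewrite (_ : 2 * (2 * h) = 4 * h)//; ring.
Qed.

Let osech_ge0 h : 0 < h -> 0 <= A h - A (2 * h).
Proof.
move=> h0; apply: has_nnsum_ge0; apply: has_sum_nnsum (has_sum_osechz h0) => n.
by rewrite /osechz; case: ifP => // _; rewrite ltW ?sechz_gt0.
Qed.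

Let pi_pos : 0 < pi :> R := pi_gt0 R.

Let cvg_half : 1 + 2^-1 ^+ n @[n --> \oo] --> (1 : R).
Proof.
rewrite -[X in _ --> X]addr0; apply: cvgD; first exact: cvg_cst.
by apply: cvg_expr; rewrite ger0_norm; lra.
Qed.

Let cvg_halfN : 1 - 2^-1 ^+ n @[n --> \oo] --> (1 : R).
Proof.
rewrite -[X in _ --> X]subr0; apply: cvgB; first exact: cvg_cst.
by apply: cvg_expr; rewrite ger0_norm; lra.
Qed.

(** Equality of the second initial values amounts to A(pi / 2) = 2 A(2 pi), an instance of the
    Poisson relation h A(h) = pi A(pi^2 / h). *)
Lemma osech_sum_pi : 2 * osech_sum (pi / 2) ^+ 2 = sech_sum pi ^+ 2 :> R.
Proof.
pose x n : R := 2 ^+ n * pi.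
have x0 n : 0 < x n by rewrite mulr_gt0 ?exprn_gt0.
have xS n : 2 * x n = x n.+1 by rewrite /x exprS mulrA.
have xSS n : 4 * x n = x n.+2 by rewrite /x !exprS; ring.
pose a n := A (x n); pose b n := 2 * A (x n.+1) - A (x n).
(* With x = [x n], [A_rel] gives (2 A(4x) - A(2x))^2 = A(2x)^2 - (A(x) - A(2x))^2 = A(x) (2 A(2x) -
   A(x)). *)
have b_rel n : b n.+1 ^+ 2 = a n * b n.
  by have := A_rel (x0 n); rewrite xS xSS /a /b => h; nra.
have ab : agm_iteration a b.
  move=> n; split=> //; first exact: A_gt0.
  - by rewrite -(@pmulr_rge0 _ (a n)) ?A_gt0// -b_rel sqr_ge0.
  - by rewrite /b /a; field.
pose y n : R := 2^-1 ^+ n * pi.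
have y0 n : 0 < y n by rewrite mulr_gt0 ?exprn_gt0.
have yS n : 2 * y n.+1 = y n by rewrite /y exprS; field.
have ySS n : 4 * y n.+2 = y n by rewrite /y !exprS; field.
pose a' n := 2^-1 ^+ n * A (y n); pose b' n := 2^-1 ^+ n * (A (y n.+1) - A (y n)).
have ab' : agm_iteration a' b'.
  move=> n; split.
  - by rewrite mulr_gt0 ?exprn_gt0// A_gt0.
  - by rewrite mulr_ge0 ?exprn_ge0// -(yS n) osech_ge0.
  - by rewrite /a' /b' exprS; field.
  - rewrite /a' /b' exprMn -{1}(yS n.+1) A_rel// ySS yS [2^-1 ^+ n.+1]exprS.
    by field.
(* For large steps [sech_sum_pi] reads A(x) <= 1 + pi / x; for small steps it squeezes [a'] between
   1 - 2^-n and 1 + 2^-n. *)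
have a1 : a @ \oo --> (1 : R).
  apply: (@squeeze_cvgr _ \oo _ _ (fun=> 1) _ _ _ _ (cvg_cst _) cvg_half).
  apply: nearW => n.
  rewrite sech_sum_ge1//=; have /andP[_ h] := sech_sum_pi (x0 n).
  rewrite -(@ler_pM2l _ (x n))//; apply: (le_trans h).
  by rewrite mulrDr mulr1 /x addrC lerD2l mulrAC -exprMn mulfV// expr1n mul1r.
have a'1 : a' @ \oo --> (1 : R).
  apply: (@squeeze_cvgr _ \oo _ _ _ _ _ _ _ cvg_halfN cvg_half).
  apply: nearW => n.
  have := sech_sum_pi (y0 n); rewrite -/A.
  have -> : y n * A (y n) = pi * a' n by rewrite /y /a'; ring.
  have -> : pi - y n = pi * (1 - 2^-1 ^+ n) by rewrite /y; ring.
  have -> : pi + y n = pi * (1 + 2^-1 ^+ n) by rewrite /y; ring.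
  by rewrite !ler_pM2l.
have a00 : a 0%N = a' 0%N by rewrite /a /a' /x /y !expr0 !mul1r.
have := agm_limit_inj ab ab' a00 a1 a'1.
rewrite /b /b' /x /y !expr0 !expr1 !mul1r => e.
have hp : 0 < pi / 2 :> R by rewrite divr_gt0.
have := A_rel hp; rewrite /osech_sum -/A.
have -> : 2 * (pi / 2) = pi :> R by field.
have -> : 4 * (pi / 2) = 2 * pi :> R by field.
have {}e : A (pi / 2) - A pi = 2 * A (2 * pi) - A pi by rewrite e mulrC.
move: e; set X := A (pi / 2) - A pi => e sq.
(* One square is replaced through [A_rel], the other through [e]: with u = A(pi) and v = A(2 pi), 4
   v (u - v) + (2 v - u)^2 = u^2. *)
have -> : 2 * X ^+ 2 = X ^+ 2 + X ^+ 2 by ring.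
by rewrite {1}sq e -/A; ring.
Qed.

End lemniscatic.

(** * Moments *)

(** Indices must become numerals before the values already found can be substituted. *)
Ltac eval_coefficients := repeat match goal with
  | |- context [binomial ?n ?m] =>
    let v := eval vm_compute in (binomial n m) in change (binomial n m) with v
  | |- context [subn ?n ?m] =>
    let v := eval vm_compute in (subn n m) in change (subn n m) with v
  end.

(** These are the derivatives at 0 for the system F' = S C, C' = S F, S' = F C. By parity F and C
    vanish at odd orders and S at even ones; C and S keep one factor [b]. *)
Lemma moment_values {R : realType} (F C S : R^nat) (a b : R) :
  F 0%N = a -> C 0%N = b -> S 0%N = 0 -> 2 * b ^+ 2 = a ^+ 2 ->
  (forall k, F k.+1 = \sum_(i < k.+1) S (k - i)%N * C i *+ 'C(k, i)) ->
  (forall k, C k.+1 = \sum_(i < k.+1) S (k - i)%N * F i *+ 'C(k, i)) ->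
  (forall k, S k.+1 = \sum_(i < k.+1) F (k - i)%N * C i *+ 'C(k, i)) ->
  [/\ F 2%N = a ^+ 3 / 2, F 4%N = 9 / 4 * a ^+ 5, F 6%N = 153 / 8 * a ^+ 7 &
      F 8%N = 4977 / 16 * a ^+ 9].
Proof.
move=> F0 C0 S0 ab recF recC recS.
have b2 : b ^+ 2 = a ^+ 2 / 2 by rewrite -ab; field.
have expand (G H : R^nat) k : \sum_(i < k.+1) G (k - i)%N * H i *+ 'C(k, i) =
    \sum_(0 <= i < k.+1) ('C(k, i))%:R * (G (k - i)%N * H i).
  by rewrite big_mkord; apply: eq_bigr => i _; rewrite mulr_natl.
have F1 : F 1%N = 0.
  by rewrite recF expand unlock /=; eval_coefficients; rewrite S0; ring.
have C1 : C 1%N = 0.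
  by rewrite recC expand unlock /=; eval_coefficients; rewrite S0; ring.
have S1 : S 1%N = a * b.
  by rewrite recS expand unlock /=; eval_coefficients; rewrite F0 C0; ring.
(* Both S and C carry a factor [b], so F from order 2 on contains [b ^+ 2], which is traded for
   [a ^+ 2 / 2]. *)
have reduce (x q : R) n : x = q * 2 * b ^+ 2 * a ^+ n -> x = q * a ^+ n.+2.
  by move=> ->; rewrite b2 -[n.+2]add2n [a ^+ (2 + n)]exprD; field.
have F2 : F 2%N = 2^-1 * a ^+ 3.
  apply: reduce; rewrite recF expand unlock /=; eval_coefficients.
  by rewrite S0 S1 C0 C1; field.
have C2 : C 2%N = 1 * a ^+ 2 * b.
  rewrite recC expand unlock /=; eval_coefficients.
  by rewrite S0 S1 F0 F1; field.
have S2 : S 2%N = 0.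
  rewrite recS expand unlock /=; eval_coefficients.
  by rewrite F0 F1 C0 C1; field.
have F3 : F 3%N = 0.
  rewrite recF expand unlock /=; eval_coefficients.
  by rewrite S0 S1 S2 C0 C1 C2; field.
have C3 : C 3%N = 0.
  rewrite recC expand unlock /=; eval_coefficients.
  by rewrite S0 S1 S2 F0 F1 F2; field.
have S3 : S 3%N = 3 / 2 * a ^+ 3 * b.
  rewrite recS expand unlock /=; eval_coefficients.
  by rewrite F0 F1 F2 C0 C1 C2; field.
have F4 : F 4%N = 9 / 4 * a ^+ 5.
  apply: reduce; rewrite recF expand unlock /=; eval_coefficients.
  by rewrite S0 S1 S2 S3 C0 C1 C2 C3; field.
have C4 : C 4%N = 3 * a ^+ 4 * b.
  rewrite recC expand unlock /=; eval_coefficients.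
  by rewrite S0 S1 S2 S3 F0 F1 F2 F3; field.
have S4 : S 4%N = 0.
  rewrite recS expand unlock /=; eval_coefficients.
  by rewrite F0 F1 F2 F3 C0 C1 C2 C3; field.
have F5 : F 5%N = 0.
  rewrite recF expand unlock /=; eval_coefficients.
  by rewrite S0 S1 S2 S3 S4 C0 C1 C2 C3 C4; field.
have C5 : C 5%N = 0.
  rewrite recC expand unlock /=; eval_coefficients.
  by rewrite S0 S1 S2 S3 S4 F0 F1 F2 F3 F4; field.
have S5 : S 5%N = 33 / 4 * a ^+ 5 * b.
  rewrite recS expand unlock /=; eval_coefficients.
  by rewrite F0 F1 F2 F3 F4 C0 C1 C2 C3 C4; field.
have F6 : F 6%N = 153 / 8 * a ^+ 7.
  apply: reduce; rewrite recF expand unlock /=; eval_coefficients.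
  by rewrite S0 S1 S2 S3 S4 S5 C0 C1 C2 C3 C4 C5; field.
have C6 : C 6%N = 27 * a ^+ 6 * b.
  rewrite recC expand unlock /=; eval_coefficients.
  by rewrite S0 S1 S2 S3 S4 S5 F0 F1 F2 F3 F4 F5; field.
have S6 : S 6%N = 0.
  rewrite recS expand unlock /=; eval_coefficients.
  by rewrite F0 F1 F2 F3 F4 F5 C0 C1 C2 C3 C4 C5; field.
have F7 : F 7%N = 0.
  rewrite recF expand unlock /=; eval_coefficients.
  by rewrite S0 S1 S2 S3 S4 S5 S6 C0 C1 C2 C3 C4 C5 C6; field.
have C7 : C 7%N = 0.
  rewrite recC expand unlock /=; eval_coefficients.
  by rewrite S0 S1 S2 S3 S4 S5 S6 F0 F1 F2 F3 F4 F5 F6; field.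
have S7 : S 7%N = 819 / 8 * a ^+ 7 * b.
  rewrite recS expand unlock /=; eval_coefficients.
  by rewrite F0 F1 F2 F3 F4 F5 F6 C0 C1 C2 C3 C4 C5 C6; field.
have F8 : F 8%N = 4977 / 16 * a ^+ 9.
  apply: reduce; rewrite recF expand unlock /=; eval_coefficients.
  by rewrite S0 S1 S2 S3 S4 S5 S6 S7 C0 C1 C2 C3 C4 C5 C6 C7; field.
by split=> //; rewrite F2 mulrC.
Qed.

Section moments.
Context {R : realType}.
Implicit Types (u v w : int -> R) (h : R).

Definition moment u (k : nat) : R :=
  xget 0 [set a | has_sum (fun n => n%:~R ^+ k * u n) a].

Definition has_moment u (k : nat) := exists a, has_sum (fun n => n%:~R ^+ k * u n) a.

Lemma has_sum_moment u k : has_moment u k ->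
  has_sum (fun n => n%:~R ^+ k * u n) (moment u k).
Proof.
by move=> -[a ua]; exact: (@xgetPex _ 0 [set a | has_sum _ a] (ex_intro _ a ua)).
Qed.

Lemma momentE u k a : has_sum (fun n => n%:~R ^+ k * u n) a -> moment u k = a.
Proof. by move=> ua; apply: (has_sum_inj _ ua); apply: has_sum_moment; exists a. Qed.

(** The factor m in the convolution raises the order by one: moments of [u] and [v] up to k give the
    moment of order k + 1 of [w]. *)
Lemma has_sum_momentS u v w k :
  (forall i, (i <= k)%N -> has_moment u i) ->
  (forall i, (i <= k)%N -> has_moment v i) ->
  (forall m, has_sum (fun n => u n * v (m - n)) (m%:~R * w m)) ->
  has_sum (fun m => m%:~R ^+ k.+1 * w m)
    (\sum_(i < k.+1) moment u (k - i)%N * moment v i *+ 'C(k, i)).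
Proof.
move=> uk vk uvw.
have := @has_sum_moment_convolution R u v _ (moment u) (moment v) k
  (fun i ik => has_sum_moment (uk i ik)) (fun i ik => has_sum_moment (vk i ik)) uvw.
by apply: eq_has_sum => m; rewrite exprSr mulrA.
Qed.

(** As [ocschz] is supported on odd n, the parity of m fixes that of m - n; [has_sum_ocschz_sechz]
    thus splits into this identity and the next. *)
Lemma has_sum_ocschz_osechz h m : 0 < h ->
  has_sum (fun n => ocschz h n * osechz h (m - n)) (m%:~R * esechz h m).
Proof.
move=> h0; rewrite /esechz; case: eqP => m0.
  apply: eq_has_sum (has_sum_ocschz_sechz m h0) => n.
  rewrite /ocschz /osechz; case: eqP => n1; last by rewrite !mul0r.
  by have -> : ((m - n) %% 2)%Z == 1 by lia.
rewrite mulr0; apply: eq_has_sum has_sum0 => n.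
rewrite /ocschz /osechz; case: eqP => n1; last by rewrite mul0r.
have -> : ((m - n) %% 2)%Z == 1 = false by lia.
by rewrite mulr0.
Qed.

Lemma has_sum_ocschz_esechz h m : 0 < h ->
  has_sum (fun n => ocschz h n * esechz h (m - n)) (m%:~R * osechz h m).
Proof.
move=> h0; rewrite /osechz; case: eqP => m1.
  apply: eq_has_sum (has_sum_ocschz_sechz m h0) => n.
  rewrite /ocschz /esechz; case: eqP => n1; last by rewrite !mul0r.
  by have -> : ((m - n) %% 2)%Z == 0 by lia.
rewrite mulr0; apply: eq_has_sum has_sum0 => n.
rewrite /ocschz /esechz; case: eqP => n1; last by rewrite mul0r.
have -> : ((m - n) %% 2)%Z == 0 = false by lia.
by rewrite mulr0.
Qed.

(** The induction is simultaneous because the next moment of each family comes from lower moments of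
    the other two. *)
Lemma has_moments h k : 0 < h ->
  [/\ has_moment (esechz h) k, has_moment (osechz h) k & has_moment (ocschz h) k].
Proof.
move=> h0; elim/ltn_ind: k => -[_|k ih].
  have z u a : has_sum u a -> has_moment u 0.
    by move=> ua; exists a; apply: eq_has_sum ua => n; rewrite expr0 mul1r.
  have [a ha] := ocschz_summable h0.
  by split; [exact: z (has_sum_esechz h0)|exact: z (has_sum_osechz h0)|exact: z ha].
have e i : (i <= k)%N -> has_moment (esechz h) i by move=> ik; have [] := ih i ik.
have o i : (i <= k)%N -> has_moment (osechz h) i by move=> ik; have [] := ih i ik.
have c i : (i <= k)%N -> has_moment (ocschz h) i by move=> ik; have [] := ih i ik.
split.
- eexists; exact: has_sum_momentS c o (fun m => has_sum_ocschz_osechz m h0).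
- eexists; exact: has_sum_momentS c e (fun m => has_sum_ocschz_esechz m h0).
- eexists; exact: has_sum_momentS e o (fun m => has_sum_esechz_osechz_ocschz m h0).
Qed.

Lemma moment0 u a : has_sum u a -> moment u 0 = a.
Proof.
by move=> ua; apply: momentE; apply: eq_has_sum ua => n; rewrite expr0 mul1r.
Qed.

Lemma esech_moments (a := @sech_sum R pi) :
  [/\ moment (esechz (pi / 2)) 0 = a,
      moment (esechz (pi / 2)) 2 = a ^+ 3 / 2,
      moment (esechz (pi / 2)) 4 = 9 / 4 * a ^+ 5,
      moment (esechz (pi / 2)) 6 = 153 / 8 * a ^+ 7 &
      moment (esechz (pi / 2)) 8 = 4977 / 16 * a ^+ 9].
Proof.
have h0 : 0 < pi / 2 :> R by rewrite divr_gt0 ?pi_gt0.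
set h := pi / 2 in h0 *.
have hm k := has_moments k h0.
have F0 : moment (esechz h) 0 = a.
  rewrite (moment0 (has_sum_esechz h0)) /a; congr sech_sum.
  by rewrite /h; field.
have C0 := moment0 (has_sum_osechz h0).
have S0 : moment (ocschz h) 0 = 0.
  have [c hc] := ocschz_summable h0; rewrite (moment0 hc).
  suff : c = - c by lra.
  apply: has_sum_inj (has_sum_reindex bijective_opp_int hc) _.
  by apply: eq_has_sum (has_sumN hc) => n /=; rewrite ocschzN.
have [] := moment_values F0 C0 S0 osech_sum_pi; last by split.
- move=> k; apply: momentE; apply: has_sum_momentS.
  + by move=> i _; have [] := hm i.
  + by move=> i _; have [] := hm i.
  + by move=> m; exact: has_sum_ocschz_osechz.
- move=> k; apply: momentE; apply: has_sum_momentS.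
  + by move=> i _; have [] := hm i.
  + by move=> i _; have [] := hm i.
  + by move=> m; exact: has_sum_ocschz_esechz.
- move=> k; apply: momentE; apply: has_sum_momentS.
  + by move=> i _; have [] := hm i.
  + by move=> i _; have [] := hm i.
  + by move=> m; exact: has_sum_esechz_osechz_ocschz.
Qed.

(** The index 2 j at step pi / 2 has argument pi j, and its power contributes the factor 2^k. *)
Lemma has_sum_sech_moment k :
  has_sum (fun n : int => n%:~R ^+ k * sech (pi * n%:~R) : R)
    (moment (esechz (pi / 2)) k / 2 ^+ k).
Proof.
have h0 : 0 < pi / 2 :> R by rewrite divr_gt0 ?pi_gt0.
have [/has_sum_moment hk _ _] := has_moments k h0.
have : has_sum ((fun n => n%:~R ^+ k * esechz (pi / 2) n) \o (fun j : int => 2 * j))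
    (moment (esechz (pi / 2)) k).
  apply/has_sum_support => // [i j|n hn]; first by lia.
  rewrite /esechz; case: eqP => n0; last by rewrite mulr0.
  by have := hn (n %/ 2)%Z; lia.
move=> /(has_sumZ (2 ^- k)); rewrite [X in has_sum _ X]mulrC.
apply: eq_has_sum => j /=.
have e : ((2 * j) %% 2)%Z = 0 by lia.
rewrite /esechz e eqxx /sechz intrM exprMn mulrA mulKf ?expf_neq0//.
by congr (_ * sech _); field.
Qed.

Lemma has_sum_sech_odd_moment k : odd k ->
  has_sum (fun n : int => n%:~R ^+ k * sech (pi * n%:~R) : R) 0.
Proof.
move=> ko; have hk := has_sum_sech_moment k; set a := _ / _ in hk.
suff a0 : a = - a by have -> : 0 = a; [lra|].
apply: has_sum_inj (has_sum_reindex bijective_opp_int hk) _.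
apply: eq_has_sum (has_sumN hk) => n /=.
by rewrite !mulrNz mulrN sechN exprNn -signr_odd ko expr1 mulN1r mulNr.
Qed.

End moments.

(** * Expectations of functions of an integer-valued variable *)

Section integer_valued.
Context {R : realType} {d : measure_display} {T : measurableType d}.
Context (P : probability T R) (X : {RV P >-> int}) (q : int -> R).
Context (lawX : forall k : int, P (X @^-1` [set k]) = (q k)%:E).

Let q_ge0 k : 0 <= q k.
Proof. by rewrite -lee_fin -lawX measure_ge0. Qed.

(** The integrand is constant on each event X = k, and these countably many events partition the
    space. *)
Lemma ge0_integral_int (g : int -> R) : (forall k, 0 <= g k) ->
  (\int[P]_w (g (X w))%:E = \esum_(k in [set: int]) (g k * q k)%:E)%E.
Proof.
move=> g0.
have mX k : measurable (X @^-1` [set k]).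
  by rewrite -[X in measurable X]setTI; exact: measurable_funPT.
have mg : measurable_fun [set: T] (g \o X).
  by apply: (@measurableT_comp _ _ _ _ _ _ g) => // _ Y _; rewrite setTI.
(* Countable additivity is indexed by naturals, so integers are coded by [pickle]; codes outside its
   range give empty sets. *)
pose F (n : nat) : set T := [set w | pickle (X w) = n].
have FE k : F (pickle k) = X @^-1` [set k].
  by apply/seteqP; rewrite /F; split=> w /=; [exact: pcan_inj pickleK _ _|move=> ->].
have F0 n : ~ range (@pickle int) n -> F n = set0.
  by move=> hn; rewrite -subset0 => w /= Fw; apply: hn; exists (X w).
have mF n : measurable (F n).
  by have [[k _ <-]|/F0 ->] := pselect (range (@pickle int) n); rewrite ?FE.
have UF : \bigcup_n F n = [set: T].
  by rewrite -subTset => w _; exists (pickle (X w)).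
rewrite -[in LHS]UF ge0_integral_bigcup//=; last 3 first.
- by rewrite UF; exact/measurable_EFinP.
- by move=> w _; rewrite lee_fin.
- by move=> i j _ _ [w [<- <-]].
rewrite nneseries_esumT; last by move=> n; apply: integral_ge0 => w _; rewrite lee_fin.
transitivity (\esum_(n in range (@pickle int)) \int[P]_(w in F n) (g (X w))%:E)%E.
  rewrite [RHS]esum_mkcond; apply: eq_esum => n _; case: ifPn => // /negP hn.
  by rewrite F0 ?integral_set0// => hn'; apply: hn; rewrite inE.
rewrite esum_image; last by move=> x y _ _; exact: pcan_inj pickleK _ _.
apply: eq_esum => k _; rewrite FE.
rewrite (eq_integral (cst (g k)%:E)); last by move=> w /[!inE] /= ->.
by rewrite integral_cst// EFinM; congr (_ * _)%E; exact: lawX.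
Qed.

(** Positive and negative parts are integrated separately; since [q] is non-negative it passes
    through the maximum. *)
Lemma expectation_int (g : int -> R) l : has_sum (fun k => g k * q k) l ->
  ('E_P[(fun w => g (X w))%R] = l%:E)%E.
Proof.
move=> /has_sum_posneg[a [b [[_ ga] [_ gb] ->]]].
rewrite unlock integralE EFinB -ga -gb; congr (_ - _)%E.
- transitivity (\int[P]_w (Num.max (g (X w)) 0)%:E)%E.
    by apply: eq_integral => w _; rewrite funeposE EFin_max.
  rewrite (@ge0_integral_int (fun k => Num.max (g k) 0)); last first.
    by move=> k; rewrite le_max lexx orbT.
  by apply: eq_esum => k _; rewrite maxr_pMl// mul0r.
- transitivity (\int[P]_w (Num.max (- g (X w)) 0)%:E)%E.
    by apply: eq_integral => w _; rewrite funenegE EFin_max.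
  rewrite (@ge0_integral_int (fun k => Num.max (- g k) 0)); last first.
    by move=> k; rewrite le_max lexx orbT.
  by apply: eq_esum => k _; rewrite maxr_pMl// mul0r mulNr.
Qed.

(** Integrating the constant 1 gives the normalization that identifies A(pi) with sqrt 2 G. *)
Lemma has_sum_law : has_sum q 1.
Proof.
apply: nnsum_has_sum; split=> //.
have := @ge0_integral_int (fun=> 1) (fun=> ler01).
rewrite integral_cst//= probability_setT mule1 => ->.
by apply: eq_esum => k _; rewrite mul1r.
Qed.

End integer_valued.

(** * Moments of the hyperbolic secant law *)

Theorem theorem3p1 (R : realType) (d : measure_display)
    (T : measurableType d) (P : probability T R) (X : {RV P >-> int})
    (lawX : forall k : int,
       P (X @^-1` [set k])
       = (1 / (Num.sqrt 2 * gauss) * sech (pi * k%:~R))%:E) :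
  (forall n : nat, odd n -> 'E_P[(fun w => (X w)%:~R ^+ n)%R] = 0)%E /\
  ('E_P[(fun w => (X w)%:~R ^+ 2)%R] = 'V_P[(fun w => (X w)%:~R)%R])%E /\
  ('V_P[(fun w => (X w)%:~R)%R] = ((gauss / 2) ^+ 2)%R%:E)%E /\
  ('E_P[(fun w => (X w)%:~R ^+ 4)%R] = (9 * (gauss / 2) ^+ 4)%R%:E)%E /\
  ('E_P[(fun w => (X w)%:~R ^+ 6)%R] = (153 * (gauss / 2) ^+ 6)%R%:E)%E /\
  ('E_P[(fun w => (X w)%:~R ^+ 8)%R] = (4977 * (gauss / 2) ^+ 8)%R%:E)%E.
Proof.
set c := 1 / _ in lawX; pose a : R := sech_sum pi.
have [F0 F2 F4 F6 F8] := @esech_moments R.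
have ca : c * a = 1.
  have := has_sumZ c (has_sum_sech_moment 0); rewrite F0 expr0 divr1.
  move=> h; apply: (has_sum_inj _ (has_sum_law lawX)).
  by apply: eq_has_sum h => k; rewrite expr0 mul1r.
(* Since the inverse of 0 is 0, a vanishing [gauss] would give c = 0, against [ca]. *)
have g0 : gauss != 0 :> R.
  apply: contra_eq_neq ca => g0.
  by rewrite /c g0 mulr0 invr0 mulr0 mul0r eq_sym oner_neq0.
have s0 : Num.sqrt 2 != 0 :> R by rewrite sqrtr_eq0 -ltNge.
have a2 : a ^+ 2 = 2 * gauss ^+ 2.
  have -> : a = Num.sqrt 2 * gauss.
    transitivity (Num.sqrt 2 * gauss * (c * a)); last by rewrite ca mulr1.
    by rewrite /c; field; rewrite g0 s0.
  by rewrite exprMn sqr_sqrtr.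
have moments n l : has_sum (fun k : int => k%:~R ^+ n * sech (pi * k%:~R) : R) l ->
    ('E_P[(fun w => (X w)%:~R ^+ n)%R] = (c * l)%:E)%E.
  move=> /(has_sumZ c) h.
  apply: (@expectation_int _ _ _ P X _ lawX (fun k => k%:~R ^+ n)).
  by apply: eq_has_sum h => k; rewrite mulrCA.
(* The normalization [c] absorbs one factor [a]; the remaining even power becomes a power of 2
   G^2. *)
have E n x m : moment (esechz (pi / 2)) n = x * (a * a ^+ 2 ^+ m) ->
    ('E_P[(fun w => (X w)%:~R ^+ n)%R] = (x * (2 * gauss ^+ 2) ^+ m / 2 ^+ n)%:E)%E.
  move=> e; rewrite (moments _ _ (has_sum_sech_moment n)) e a2; congr EFin.
  set y := _ ^+ m; transitivity (c * a * (x * y / 2 ^+ n)); last by rewrite ca mul1r.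
  by field; rewrite expf_neq0.
have odd0 n : odd n -> ('E_P[(fun w => (X w)%:~R ^+ n)%R] = 0)%E.
  by move=> /has_sum_sech_odd_moment/moments ->; rewrite mulr0.
have E2 : ('E_P[(fun w => (X w)%:~R ^+ 2)%R] = ((gauss / 2) ^+ 2)%R%:E)%E.
  rewrite (E 2%N 2^-1 1%N); first by congr EFin; field.
  by rewrite F2 /a; field.
(* The mean vanishes by the odd case of order 1, so centring changes nothing. *)
have V2 : ('V_P[(fun w => (X w)%:~R)%R] = 'E_P[(fun w => (X w)%:~R ^+ 2)%R])%E.
  have E1 : ('E_P[(fun w => (X w)%:~R)%R] = 0)%E by exact: (odd0 1%N).
  rewrite /variance unlock E1 /=; congr expectation; apply/funext => w /=.
  transitivity (((X w)%:~R - 0) * ((X w)%:~R - 0) : R) => //.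
  by rewrite subr0 expr2.
split; first exact: odd0.
rewrite V2 E2; split=> //; split=> //; split; last split.
- rewrite (E 4%N (9 / 4) 2%N); first by congr EFin; field.
  by rewrite F4 /a; field.
- rewrite (E 6%N (153 / 8) 3%N); first by congr EFin; field.
  by rewrite F6 /a; field.
- rewrite (E 8%N (4977 / 16) 4%N); first by congr EFin; field.
  by rewrite F8 /a; field.
Qed.
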